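(* Let $N\ge 1$ be an integer, $m>0$, and let the offspring distribution of a Bienaymé–Galton–Watson process have the Poisson probability generating function $f(s)=e^{m(s-1)}$. Let $V_N$ be the number of disjoint complete infinite $N$-ary subtrees rooted at the ancestor of the family tree. Let $\tau_N$ be the largest solution in $[0,1]$ of the equation $$(1-s)e^{ms}=\sum_{j=0}^{N-1}\frac{(ms)^j}{j!}.$$ Then for every $j=0,1,2,\ldots$ $$P(V_N=j)=P(jN\le Y_N\le jN+N-1),$$ where $Y_N$ has the Poisson distribution $$P(Y_N=k)=\frac{(m\tau_N)^k e^{-m\tau_N}}{k!},\qquad k=0,1,2,\ldots.$$
   Context: The process starts with one ancestor (the root); each individual independently has $k$ children with probability $p_k$, where $f(s)=\sum_k p_k s^k$. The family tree has the individuals as nodes and the parent–child relations as arcs. A complete infinite $N$-ary tree is a rooted tree in which every node has exactly $N$ children. Subtrees considered are those rooted at the ancestor; two such subtrees are disjoint if they have no common node other than the root. $V_N$ is the (maximal) number of pairwise disjoint complete infinite $N$-ary subtrees of the family tree rooted at the ancestor. Convention: $0^0=1$ (if $\tau_N=0$, $Y_N=0$ almost surely). *)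

(* Defs.v *)
From HB Require Import structures.
From mathcomp Require Import all_boot all_order all_algebra.
From mathcomp Require Import all_classical all_reals all_analysis.

Set Implicit Arguments.
Unset Strict Implicit.
Unset Printing Implicit Defensive.

Import Order.TTheory GRing.Theory Num.Theory.

Local Open Scope classical_set_scope.
Local Open Scope ring_scope.

Definition mutually_independent (R : realType)
    (d : measure_display) (T : measurableType d) (P : probability T R)
    (d' : measure_display) (T' : measurableType d')
    (I : choiceType) (X : I -> {RV P >-> T'}) : Prop :=
  forall (s : seq I) (A : I -> set T'),
    uniq s -> (forall i, measurable (A i)) ->
    P (\bigcap_(i in [set` s]) (X i @^-1` A i)) =
      (\prod_(i <- s) P (X i @^-1` A i))%E.

(* Individuals carry Ulam-Harris labels: the root is [::] and the children of
   [u] are [rcons u i] for [i] smaller than the number of children of [u].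
   [xi u] is the number of children of the individual labelled [u]; it is also
   defined for the labels [u] which do not occur in the family tree. *)
Definition BGW_process (R : realType)
    (d : measure_display) (T : measurableType d) (P : probability T R)
    (p : nat -> R) (xi : seq nat -> {RV P >-> nat}) : Prop :=
  mutually_independent xi /\
  forall (u : seq nat) (k : nat), P (xi u @^-1` [set k]) = (p k)%:E.

Definition pgf (R : realType) (p : nat -> R) (s : R) : \bar R :=
  (\sum_(0 <= k <oo) (p k * s ^+ k)%:E)%E.

Inductive family_tree (c : seq nat -> nat) : set (seq nat) :=
| family_tree_root : family_tree c [::]
| family_tree_child (u : seq nat) (i : nat) :
    family_tree c u -> (i < c u)%N -> family_tree c (rcons u i).

Definition rooted_subtree (t S : set (seq nat)) : Prop :=
  [/\ S `<=` t, S [::] & forall u i, S (rcons u i) -> S u].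

(* Such a subtree is automatically infinite when [0 < N]. *)
Definition complete_Nary (N : nat) (S : set (seq nat)) : Prop :=
  forall u, S u -> ([set i | S (rcons u i)] #= `I_N)%card.

Definition has_disjoint_Nary (N : nat) (t : set (seq nat)) (j : nat) : Prop :=
  exists F : 'I_j -> set (seq nat),
    (forall a, rooted_subtree t (F a) /\ complete_Nary N (F a)) /\
    (forall a b, a != b -> F a `&` F b `<=` [set [::]]).

(* The maximum exists when [t] is a family tree and [0 < N], since then j
   disjoint subtrees use up j * N distinct children of the root; the default
   value 0 of [xget] is thus never used in that case. *)
Definition max_disjoint_Nary (N : nat) (t : set (seq nat)) : nat :=
  xget 0%N [set j | has_disjoint_Nary N t j /\
                    forall i, has_disjoint_Nary N t i -> (i <= j)%N].

Definition V (T : Type) (xi : seq nat -> T -> nat) (N : nat) (w : T) : nat :=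
  max_disjoint_Nary N (family_tree (fun u => xi u w)).

Definition tau_equation (R : realType) (m : R) (N : nat) (s : R) : Prop :=
  (1 - s) * expR (m * s) = \sum_(0 <= j < N) (m * s) ^+ j / j`!%:R.

Definition largest_solution (R : realType) (m : R) (N : nat) (tau : R) : Prop :=
  [/\ 0 <= tau <= 1, tau_equation m N tau &
      forall s, 0 <= s <= 1 -> tau_equation m N s -> s <= tau].

(* Main.v *)
(* Call an individual surviving if it is the root of a complete infinite N-ary
   subtree. By finite branching this holds iff at least N of its children are
   surviving, so V_N is the quotient by N of the number Z of surviving children
   of the ancestor. Distinct children survive independently with the same
   probability a, so Z is a thinning of a Poisson(m) variable, that is a
   Poisson(m a) variable, and it remains to see that a = tau. First,
   a = P(Poisson(m a) >= N) is the equation defining tau, hence a <= tau.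
   Conversely a is the limit of the probabilities a_n of having an N-ary tree of
   height n, where a_0 = 1 and a_{n+1} = P(Poisson(m a_n) >= N); this map is
   monotone and fixes tau, so tau <= a_n for all n. *)
Require Import Defs.
From mathcomp Require Import all_boot all_order all_algebra.
From mathcomp Require Import all_classical all_reals all_analysis.
From mathcomp Require Import finmap zify ring lra.

Set Implicit Arguments.
Unset Strict Implicit.
Unset Printing Implicit Defensive.

Import Order.TTheory GRing.Theory Num.Theory.
Import numFieldNormedType.Exports.

Local Open Scope classical_set_scope.
Local Open Scope ring_scope.

(** * N-ary subtrees of a deterministic tree *)

Fixpoint has_Nary (N : nat) (c : seq nat -> nat) (n : nat) (u : seq nat) : bool :=
  if n is n'.+1 then
    (N <= count (fun i => has_Nary N c n' (rcons u i)) (iota 0 (c u)))%N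
  else true.

(** Survival is encoded through all finite heights, not through an infinite tree, so that as an
    event it is a countable intersection. The label [u] need not occur in the family tree. *)
Definition survives (N : nat) (c : seq nat -> nat) (u : seq nat) : bool :=
  `[< forall n, has_Nary N c n u >].

Definition surviving_children (N : nat) (c : seq nat -> nat) (u : seq nat) : seq nat :=
  [seq i <- iota 0 (c u) | survives N c (rcons u i)].

Lemma has_NaryW N c n u : has_Nary N c n.+1 u -> has_Nary N c n u.
Proof.
elim: n u => [//|n IH] u /= h.
by apply: leq_trans h (sub_count _ _) => i; exact: IH.
Qed.

Lemma has_Nary_leq N c m n u : (m <= n)%N -> has_Nary N c n u -> has_Nary N c m u.
Proof.
move=> /subnKC <-; elim: (n - m)%N => [|k IH]; first by rewrite addn0.
by rewrite addnS => /has_NaryW.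
Qed.

(* König's lemma in disguise: the children that have an N-ary tree of height n
   form a decreasing sequence of finite sets, which is eventually constant. *)
Lemma count_survives_eventually N c u (s : seq nat) :
  exists n, forall i, i \in s ->
    has_Nary N c n (rcons u i) = survives N c (rcons u i).
Proof.
elim: s => [|a s [n hn]]; first by exists 0%N.
have [k hk] : exists k, forall l, (k <= l)%N ->
    has_Nary N c l (rcons u a) = survives N c (rcons u a).
  have [h|/asboolPn/existsNP[k /negP hk]] := boolP (survives N c (rcons u a)).
    by exists 0%N => l _; move/asboolP: h => ->.
  exists k => l kl; apply/negbTE; apply: contra hk; exact: has_Nary_leq.
exists (maxn k n) => i; rewrite inE => /predU1P[->|si].
  by rewrite hk// leq_maxl.
apply/idP/idP => [h|/asboolP -> //].
by rewrite -hn//; apply: has_Nary_leq h; rewrite leq_maxr.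
Qed.

Lemma survivesE N c u :
  survives N c u = (N <= size (surviving_children N c u))%N.
Proof.
rewrite size_filter; apply/asboolP/idP => [h|h [//|n] /=].
  have [n hn] := count_survives_eventually N c u (iota 0 (c u)).
  (* Height [n.+1] at [u] counts the children with height [n], and [n] was chosen so that these are
     exactly the surviving ones. *)
  by have /= := h n.+1; rewrite (eq_in_count (a2 := fun i => survives N c (rcons u i))).
by apply: leq_trans h (sub_count _ _) => i /asboolP.
Qed.

(** The tree grown from the root by keeping below each node [u] only the children listed in [f u];
    it serves to build N-ary subtrees from a choice of children. *)
Inductive selected (f : seq nat -> seq nat) : set (seq nat) :=
| selected_root : selected f [::]
| selected_child u i : selected f u -> i \in f u -> selected f (rcons u i).

Lemma selected_rcons f u i : selected f (rcons u i) <-> selected f u /\ i \in f u.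
Proof.
split => [|[]]; last exact: selected_child.
move E : (rcons u i) => v h; case: h E => [|u' i' h fi] E; first by case: u E.
by move/rcons_inj: E => [-> ->].
Qed.

(** Reduces disjointness of two selected trees to disjointness of their first generations. *)
Lemma selected_cons f i u : selected f (i :: u) -> i \in f [::].
Proof.
elim/last_ind: u => [|u j IH]; rewrite -?rcons_cons.
  by rewrite -[[:: i]]/(rcons [::] i) => /selected_rcons[].
by move=> /selected_rcons[/IH].
Qed.

Lemma card_eq_seq (s : seq nat) : uniq s -> ([set` s] #= `I_(size s))%card.
Proof.
move=> us; rewrite (_ : [set` s] = [set` [fset x in s]%fset]).
  by apply/card_eq_fsetP; rewrite card_fseq undup_id.
by apply/seteqP; split => x /=; rewrite inE.
Qed.

Lemma seq_of_card (A : set nat) n : (A #= `I_n)%card ->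
  exists s : seq nat, [/\ uniq s, size s = n & A = [set` s]].
Proof.
move=> An; have fA : finite_set A by apply/finite_setP; exists n.
exists (enum_fset (fset_set A)); split; first exact: fset_uniq.
  by have := card_fset_set An.
by rewrite -[LHS]fset_setK.
Qed.

Lemma family_tree_rcons c u i : family_tree c (rcons u i) -> (i < c u)%N.
Proof.
move E : (rcons u i) => v h; case: h E => [|u' i' h fi] E; first by case: u E.
by move/rcons_inj: E => [-> ->].
Qed.

(** Induction on the height: the N children of [u] within [S] again lie in [S], so each has an N-ary
    tree of the previous height. *)
Lemma complete_Nary_survives N c S : rooted_subtree (family_tree c) S ->
  complete_Nary N S -> forall u, S u -> survives N c u.
Proof.
move=> [St _ _] NS u Su; apply/asboolP => n.
elim: n u Su => [//|n IH] u Su /=.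
have [s [us sN Es]] := seq_of_card (NS _ Su).
have Ss i : i \in s -> S (rcons u i).
  by move=> si; suff : [set i | S (rcons u i)] i by []; rewrite Es.
rewrite -size_filter -[X in (X <= _)%N]sN; apply: uniq_leq_size => // i /Ss Si.
by rewrite mem_filter /= IH// mem_iota add0n; exact: family_tree_rcons (St _ Si).
Qed.

(** Each of the j trees uses N surviving children of the root, and disjointness makes these j * N
    children distinct. Conversely, the list [L] is cut into consecutive blocks of length N, one for
    each tree. *)
Lemma has_disjoint_NaryP N c j :
  has_disjoint_Nary N (family_tree c) j <->
  (j * N <= size (surviving_children N c [::]))%N.
Proof.
set L := surviving_children N c [::].
split => [[F [hF disjF]]|jN].
- have h a : exists s : seq nat,
      [/\ uniq s, size s = N & [set i | F a (rcons [::] i)] = [set` s]].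
    by apply: seq_of_card; have [[_ F0 _]] := hF a; exact.
  have [s hs] := choice h.
  have sF a i : i \in s a -> F a [:: i].
    have [_ _ E] := hs a; move=> si.
    by suff : [set i | F a (rcons [::] i)] i by []; rewrite E.
  have szF : size (flatten [seq s a | a <- enum 'I_j]) = (j * N)%N.
    rewrite size_flatten /shape -map_comp (eq_map (g := fun=> N)); last first.
      by move=> a /=; have [_ -> _] := hs a.
    by rewrite sumnE big_map big_const_seq count_predT size_enum_ord iter_addn_0 mulnC.
  rewrite -szF; apply: uniq_leq_size => [|i /flattenP[_ /mapP[a _ ->]] /sF Fi].
    (* An index occurring in the lists of two different trees would be a common node other than the
       root. *)
    have : uniq (enum 'I_j) by exact: enum_uniq.
    elim: (enum 'I_j) => [//|a r IH] /= /andP[ar ur].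
    rewrite cat_uniq IH// andbT; have [-> _ _] := hs a; rewrite /=.
    apply/hasPn => i /flattenP[_ /mapP[b br ->]] /sF Fb.
    apply/negP => /sF Fa; have ab : a != b by apply: contraNneq ar => ->.
    by have := disjF _ _ ab [:: i] (conj Fa Fb).
  have [ra ca] := hF a.
  rewrite mem_filter (complete_Nary_survives ra ca)// mem_iota add0n.
  by case: ra => /(_ _ Fi) /(@family_tree_rcons c [::]).
(* Tree [a] takes the [a]-th block of [L] at the root and the first N surviving children everywhere
   else. *)
- pose f (a : 'I_j) u :=
    take N (if u is [::] then drop (a * N) L else surviving_children N c u).
  have fsub a u i : i \in f a u -> i \in surviving_children N c u.
    by move=> /mem_take; case: u => [/mem_drop|].
  exists (fun a => selected (f a));
    split=> [a|a b ab [//|i u] [/selected_cons fa /selected_cons fb]].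
    have fu u : uniq (f a u).
      apply: take_uniq; case: u => [|i u]; rewrite ?drop_uniq//.
        by rewrite filter_uniq// iota_uniq.
      by rewrite filter_uniq// iota_uniq.
    split; first split; [|exact: selected_root|by move=> u i /selected_rcons[]|].
      move=> u; elim => [|{}u i _ tu /fsub]; first exact: family_tree_root.
      by rewrite mem_filter mem_iota add0n => /andP[_]; exact: family_tree_child.
    move=> u Su; rewrite (_ : [set i | _] = [set` f a u]); last first.
      by apply/seteqP; split => i /=; rewrite selected_rcons; tauto.
    suff : size (f a u) = N by move=> <-; exact: card_eq_seq.
    apply: size_takel; case: Su => [|{}u i _ /fsub].
      rewrite size_drop; apply: leq_trans (leq_sub2r _ jN).
      by rewrite -mulnBl leq_pmull// subn_gt0.
    (* A selected node other than the root survives, so it has at least N surviving children to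
       choose from. *)
    rewrite mem_filter survivesE => /andP[+ _].
    by case E : (rcons u i) => [|//]; case: (u) E.
  have uL : uniq L by rewrite filter_uniq// iota_uniq.
  (* For [a < b], block [a] lies in the first [b * N] entries of the duplicate-free list [L], and
     block [b] lies beyond them. *)
  wlog lt_ab : a b ab fa fb / (a < b)%N.
    move=> H; have [lt|lt|/val_inj E] := ltngtP a b.
    - exact: (H a b).
    - by apply: (H b a) => //; rewrite eq_sym.
    - by rewrite E eqxx in ab.
  have : i \in take (b * N) L.
    move: fa; rewrite /f take_drop => /mem_drop.
    have -> : take (N + a * N) L = take (N + a * N) (take (b * N) L).
      by rewrite take_takel// -mulSn leq_mul2r lt_ab orbT.
    by move=> /mem_take.
  move: fb => /mem_take; move: uL; rewrite -{1}(cat_take_drop (b * N) L) cat_uniq.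
  by move=> /and3P[_ /hasPn h _] /h /negP.
Qed.

Lemma max_disjoint_NaryE N c : (0 < N)%N ->
  max_disjoint_Nary N (family_tree c) =
  (size (surviving_children N c [::]) %/ N)%N.
Proof.
move=> N0; apply: xget_unique => [|j [/has_disjoint_NaryP jN jmax]].
  split; first by apply/has_disjoint_NaryP; exact: leq_divM.
  by move=> i /has_disjoint_NaryP; rewrite leq_divRL.
apply/eqP; rewrite eqn_leq leq_divRL// jN.
by apply: jmax; apply/has_disjoint_NaryP; exact: leq_divM.
Qed.

(** * Independence of generated sigma-algebras *)

Section independence.
Context (R : realType) (d : measure_display) (T : measurableType d)
  (P : probability T R).

(** The finite measures sending A to P(A ∩ F) and to P(F) P(A) agree on the pi-system [G], which
    contains the whole space, hence on the sigma-algebra that it generates. *)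
Lemma pi_system_independent (G : set (set T)) (F : set T) :
  setI_closed G -> G setT -> G `<=` measurable -> measurable F ->
  (forall A, G A -> P (A `&` F) = (P A * P F)%E) ->
  forall A, <<s G >> A -> P (A `&` F) = (P A * P F)%E.
Proof.
move=> GI GT Gm mF GF A GA.
pose r : {nonneg R} := NngNum (fine_ge0 (measure_ge0 P F)).
have rE : r%:num%:E = P F by rewrite /= fineK// fin_num_measure.
suff : mrestr P mF A = mscale r P A by rewrite /mrestr /mscale rE muleC.
apply: (@g_sigma_algebra_measure_unique _ R T G Gm (fun=> setT)) => //.
- by rewrite bigcup_const//; exists 0%N.
- by move=> B /GF; rewrite /= /mrestr /mscale rE muleC.
- move=> _; rewrite /= /mrestr setTI; exact: le_lt_trans (probability_le1 P mF) (ltry _).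
Qed.

Context (d' : measure_display) (T' : measurableType d') (I : choiceType)
  (X : I -> {RV P >-> T'}).

(** Finite-dimensional events in the coordinates from [U]. Unlike the preimages under single
    coordinates they form a pi-system, and they generate the same sigma-algebra. *)
Definition cylinder (U : set I) : set (set T) :=
  [set E | exists s A, [/\ uniq s, [set` s] `<=` U,
    (forall i, measurable (A i)) &
    E = \bigcap_(i in [set` s]) (X i @^-1` A i)]].

Definition generated (U : set I) : set (set T) := <<s cylinder U >>.

Lemma cylinder_measurable U : cylinder U `<=` measurable.
Proof.
move=> E [s [A [_ _ mA ->]]]; apply: fin_bigcap_measurable => // i _.
by rewrite -[X in measurable X]setTI; exact: measurable_funPT.
Qed.

Lemma cylinderT U : cylinder U setT.
Proof.
exists [::], (fun=> setT); split=> //.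
by apply/seteqP; split => x.
Qed.

Lemma cylinder_setI U W A B : cylinder U A -> cylinder W B ->
  cylinder (U `|` W) (A `&` B).
Proof.
move=> [s [A' [us sU mA ->]]] [t [B' [ut tW mB ->]]].
(* A coordinate missing from one of the two lists gets the trivial constraint [setT] there, so both
   constraints can be imposed on the merged list. *)
exists (undup (s ++ t)),
  (fun i => (if i \in s then A' i else setT) `&` (if i \in t then B' i else setT)).
split.
- exact: undup_uniq.
- move=> i /=; rewrite mem_undup mem_cat => /orP[/sU|/tW]; by [left|right].
- by move=> i; apply: measurableI; case: ifP.
- apply/seteqP; split => [x [hA hB] i /= _|x h].
    by split; case: ifPn => //; [exact: hA|exact: hB].
  split => i /= si; have := h i; rewrite /= mem_undup mem_cat si ?orbT => /(_ isT).
    by case.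
  by case.
Qed.

Lemma generated_sub U W A : U `<=` W -> generated U A -> generated W A.
Proof.
move=> UW; move: A; apply: sub_sigma_algebra2 => E [s [A [us sU mA ->]]].
by exists s, A; split => //; exact: subset_trans UW.
Qed.

Lemma generated_measurable U : generated U `<=` measurable.
Proof.
apply: smallest_sub; last exact: cylinder_measurable.
exact: sigma_algebra_measurable.
Qed.

Lemma generated_setC U A : generated U A -> generated U (~` A).
Proof. by rewrite -setTD; exact: sigma_algebraCD. Qed.

Lemma generated_bigcup U (A : (set T)^nat) :
  (forall n, generated U (A n)) -> generated U (\bigcup_n A n).
Proof. exact: sigma_algebra_bigcup. Qed.

Lemma generated_bigcap U (A : (set T)^nat) :
  (forall n, generated U (A n)) -> generated U (\bigcap_n A n).
Proof.
move=> UA; rewrite -[X in generated _ X]setCK setC_bigcap.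
apply: generated_setC; apply: generated_bigcup => n; exact: generated_setC.
Qed.

Lemma generated_setI U A B : generated U A -> generated U B ->
  generated U (A `&` B).
Proof.
move=> UA UB; rewrite -bigcap2E.
apply: generated_bigcap => -[|[|n]] //=.
by apply: sub_sigma_algebra; exact: cylinderT.
Qed.

Lemma generated_setU U A B : generated U A -> generated U B ->
  generated U (A `|` B).
Proof.
move=> UA UB; rewrite -[X in generated _ X]setCK setCU.
apply: generated_setC; apply: generated_setI; exact: generated_setC.
Qed.

Lemma generated_preimage U i (A : set T') : U i -> measurable A ->
  generated U (X i @^-1` A).
Proof.
move=> Ui mA; apply: sub_sigma_algebra; exists [:: i], (fun=> A); split => //.
  by move=> j /=; rewrite inE => /eqP ->.
apply/seteqP; split => x /=; first by move=> h j /=; rewrite inE => /eqP ->.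
by apply; rewrite /= inE.
Qed.

Hypothesis Xind : mutually_independent X.

Lemma cylinder_independent U W A B : U `&` W `<=` set0 ->
  cylinder U A -> cylinder W B -> P (A `&` B) = (P A * P B)%E.
Proof.
move=> UW0 [s [A' [us sU mA ->]]] [t [B' [ut tW mB ->]]].
have st i : i \in s -> i \in t -> False.
  by move=> /sU Ui /tW Wi; exact: (UW0 i).
(* As [s] and [t] share no index, one family [C] describes both cylinders, and independence applies
   to the list [s ++ t]. *)
pose C i := if i \in s then A' i else B' i.
have mC i : measurable (C i) by rewrite /C; case: ifP.
have -> : \bigcap_(i in [set` s]) (X i @^-1` A' i) =
    \bigcap_(i in [set` s]) (X i @^-1` C i).
  by apply: eq_bigcapr => i /= si; rewrite /C si.
have -> : \bigcap_(i in [set` t]) (X i @^-1` B' i) =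
    \bigcap_(i in [set` t]) (X i @^-1` C i).
  by apply: eq_bigcapr => i /= ti; rewrite /C; case: ifP => // /st /(_ ti).
rewrite -bigcap_setU.
have -> : [set` s] `|` [set` t] = [set` s ++ t].
  by apply/seteqP; split => i /=; rewrite mem_cat => /orP.
rewrite !Xind// ?big_cat// cat_uniq us ut andbT /=.
by apply/hasPn => i ti; apply/negP => /st; exact.
Qed.

(** The pi-system argument is used twice: first to pass from cylinders to general events over [U]
    with [B] fixed, then likewise over [W] with a cylinder [A] fixed. *)
Lemma generated_independent U W A B : U `&` W `<=` set0 ->
  generated U A -> generated W B -> P (A `&` B) = (P A * P B)%E.
Proof.
have cI V : setI_closed (cylinder V).
  by move=> C D VC VD; rewrite -[V]setUid; exact: cylinder_setI.
move=> UW0 UA WB; move: A UA; apply: pi_system_independent => //.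
- exact: cylinderT.
- exact: cylinder_measurable.
- exact: generated_measurable WB.
move=> A UA; rewrite setIC muleC; move: B WB.
apply: pi_system_independent => //.
- exact: cylinderT.
- exact: cylinder_measurable.
- exact: cylinder_measurable UA.
by move=> B WB; rewrite setIC muleC; exact: cylinder_independent UA WB.
Qed.

End independence.

(** * Poisson distributions *)

Section poisson_mass.
Context (R : realType).
Implicit Types (x m s a : R) (p q : nat -> R).

Definition poisson_mass x (k : nat) : R := x ^+ k * expR (- x) / k`!%:R.

Lemma poisson_mass_ge0 x k : 0 <= x -> 0 <= poisson_mass x k.
Proof. by move=> x0; rewrite !mulr_ge0 ?exprn_ge0 ?expR_ge0. Qed.

Lemma nneseries_expR x : 0 <= x ->
  (\sum_(0 <= k <oo) (x ^+ k / k`!%:R)%:E = (expR x)%:E)%E.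
Proof.
move=> x0; rewrite /expR -EFin_lim; last exact: is_cvg_series_exp_coeff.
by apply/congr_lim/funext => n /=; rewrite -sumEFin.
Qed.

Lemma pgf_poisson m s : 0 <= m -> 0 <= s ->
  pgf (poisson_mass m) s = (expR (m * (s - 1)))%:E.
Proof.
move=> m0 s0; rewrite mulrBr mulr1 addrC expRD EFinM.
rewrite -(@nneseries_expR (m * s)) ?mulr_ge0// -nneseriesZl; last first.
  by move=> k _; rewrite lee_fin mulr_ge0// exprn_ge0// mulr_ge0.
apply: eq_eseriesr => k _; rewrite -EFinM /poisson_mass exprMn.
by congr (_%:E); ring.
Qed.

(** Once the equal terms below k are cancelled, division by s^k gives p_k <= q_k + s F(1) for 0 < s
    <= 1; then s tends to 0. No differentiation of power series is involved. *)
Lemma pgf_coef_le p q (F : R -> R) k :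
  (forall i, 0 <= p i) -> (forall i, 0 <= q i) ->
  (forall s, 0 <= s <= 1 -> pgf p s = (F s)%:E) ->
  (forall s, 0 <= s <= 1 -> pgf q s = (F s)%:E) ->
  (forall i, (i < k)%N -> p i = q i) -> p k <= q k.
Proof.
move=> p0 q0 hp hq pq.
have ge0 (r : nat -> R) s i :
    (forall i, 0 <= r i) -> 0 <= s -> (0 <= (r i * s ^+ i)%:E)%E.
  by move=> r0 s0; rewrite lee_fin mulr_ge0// exprn_ge0.
have F1 : 0 <= F 1.
  rewrite -lee_fin -hp ?lexx ?ler01//.
  by apply: nneseries_ge0 => n _ _; exact: ge0.
have key s : 0 < s <= 1 -> p k <= q k + s * F 1.
  move=> /andP[s0 s1]; have s01 : 0 <= s <= 1 by rewrite ltW.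
  have s0' := ltW s0.
  have : pgf p s = pgf q s by rewrite hp// hq.
  rewrite /pgf (nneseries_split 0 k); last by move=> i _; exact: ge0.
  rewrite (nneseries_split 0 k (f := fun i => (q i * _)%:E)); last first.
    by move=> i _; exact: ge0.
  rewrite add0n (_ : \sum_(0 <= i < k) (p i * s ^+ i)%:E =
      \sum_(0 <= i < k) (q i * s ^+ i)%:E)%E; last first.
    by apply: eq_big_nat => i /andP[_ /pq ->].
  (* The common head is a finite number, so it may be subtracted in the extended reals. *)
  rewrite sumEFin => /(congr1 (fun x : \bar R =>
    x - (\sum_(0 <= i < k) q i * s ^+ i)%R%:E)%E).
  rewrite !(addeC (_%:E)) !addeK// => E.
  have : ((p k * s ^+ k)%:E <= (q k * s ^+ k + s ^+ k.+1 * F 1)%:E)%E.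
    apply: (@le_trans _ _ (\sum_(k <= i <oo) (p i * s ^+ i)%:E)%E).
      rewrite (nneseries_split k 1); last by move=> i _; exact: ge0.
      rewrite addn1 big_nat1 leeDl//; apply: nneseries_ge0 => n _ _; exact: ge0.
    rewrite E (nneseries_split k 1); last by move=> i _; exact: ge0.
    rewrite addn1 big_nat1 EFinD leeD2l// EFinM -(hq 1) ?lexx ?ler01//.
    rewrite /pgf -nneseriesZl; last by move=> i _; exact: ge0.
    (* Beyond index k each power of s is at most s^(k+1), and the sum of the q_i is at most F(1). *)
    apply: (@le_trans _ _ (\sum_(k.+1 <= i <oo) ((s ^+ k.+1)%:E * (q i * 1 ^+ i)%:E))%E).
      rewrite [leLHS]eseries_cond [leRHS]eseries_cond.
      apply: lee_nneseries => [i _ _|i /= ki]; first exact: ge0.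
      rewrite -EFinM lee_fin expr1n mulr1 mulrC ler_wpM2r//.
      by rewrite ler_wiXn2l.
    rewrite [leRHS](nneseries_split 0 k.+1) ?add0n.
      rewrite leeDr// sume_ge0// => i _.
      by rewrite -EFinM lee_fin !mulr_ge0 ?exprn_ge0.
    by move=> i _; rewrite -EFinM lee_fin !mulr_ge0 ?exprn_ge0.
  rewrite lee_fin exprS (_ : _ + _ = (q k + s * F 1) * s ^+ k); last by ring.
  by rewrite ler_pM2r// exprn_gt0.
apply/ler_addgt0Pr => e e0.
(* This choice gives s F(1) <= e; the added 1 keeps the denominator positive even if F(1) = 0. *)
pose s := Num.min 1 (e / (F 1 + 1)).
have F11 : 0 < F 1 + 1 by lra.
have s0 : 0 < s by rewrite lt_min ltr01 divr_gt0.
apply: le_trans (key s _) _; first by rewrite s0 ge_min lexx.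
rewrite lerD2l (@le_trans _ _ (e / (F 1 + 1) * (F 1 + 1)))//.
  by rewrite ler_pM// ?(ltW s0)// ?ge_min ?lexx ?orbT// lerDl.
by rewrite divfK// gt_eqF.
Qed.

Lemma pgf_inj p q (F : R -> R) :
  (forall i, 0 <= p i) -> (forall i, 0 <= q i) ->
  (forall s, 0 <= s <= 1 -> pgf p s = (F s)%:E) ->
  (forall s, 0 <= s <= 1 -> pgf q s = (F s)%:E) -> p = q.
Proof.
move=> p0 q0 hp hq; apply/funext => k.
elim/ltn_ind: k => k IH; apply/eqP; rewrite eq_le.
by apply/andP; split; apply: (@pgf_coef_le _ _ F) => // i /IH.
Qed.

(** A Poisson mixture of binomial laws. Terms with n < k vanish; for n = j + k the binomial
    coefficient cancels n!, leaving the exponential series at m (1 - a). *)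
Lemma nneseries_poisson_thinning m a k : 0 <= m -> 0 <= a <= 1 ->
  (\sum_(0 <= n <oo)
     (poisson_mass m n * ('C(n, k)%:R * a ^+ k * (1 - a) ^+ (n - k)))%:E =
   (poisson_mass (m * a) k)%:E)%E.
Proof.
move=> m0 /andP[a0 a1]; have b0 : 0 <= 1 - a by lra.
pose f n := (poisson_mass m n * ('C(n, k)%:R * a ^+ k * (1 - a) ^+ (n - k)))%:E.
rewrite -[LHS]/(\sum_(0 <= n <oo) f n)%E.
have f0 n : (0 <= f n)%E.
  by rewrite lee_fin !mulr_ge0 ?poisson_mass_ge0// ?exprn_ge0.
rewrite (nneseries_split 0 k) // add0n big_nat big1 ?add0e; last first.
  by move=> i /andP[_ ik]; rewrite /f bin_small// mul0r mul0r mulr0.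
rewrite -nneseries_addn//.
have fE j : f (j + k)%N = ((poisson_mass (m * a) k * expR (m * a - m))%:E *
    ((m * (1 - a)) ^+ j / j`!%:R)%:E)%E.
  rewrite -EFinM /f /poisson_mass addnK; congr (_%:E).
  have := bin_fact (leq_addl j k); rewrite addnK => /(congr1 (fun n => n%:R : R)).
  rewrite !natrM => E.
  have fk (i : nat) : i`!%:R != 0 :> R by rewrite pnatr_eq0 -lt0n fact_gt0.
  have -> : expR (- m) = expR (- (m * a)) * expR (m * a - m).
    by rewrite -expRD; congr expR; ring.
  rewrite !exprMn exprD -E; field; rewrite !fk /=.
  by rewrite pnatr_eq0 -lt0n bin_gt0 leq_addl.
rewrite (eq_eseriesr (fun j _ => fE j)) nneseriesZl; last first.
  by move=> j _; rewrite lee_fin mulr_ge0// exprn_ge0// mulr_ge0.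
rewrite nneseries_expR ?mulr_ge0// -EFinM -mulrA -expRD.
by rewrite (_ : m * a - m + m * (1 - a) = 0) ?expR0 ?mulr1//; ring.
Qed.

(** The probability that a Poisson(x) variable is strictly less than N. *)
Definition poisson_cdf (N : nat) x := \sum_(0 <= k < N) poisson_mass x k.

Lemma is_derive_expRN x : is_derive x 1 (fun y : R => expR (- y)) (- expR (- x)).
Proof.
have h : is_derive x 1 (expR \o -%R) (expR (- x) * -1) by apply: is_derive1_comp.
by rewrite -mulrN1.
Qed.

Lemma is_derive_poisson_mass x k :
  is_derive x 1 (poisson_mass ^~ k.+1) (poisson_mass x k - poisson_mass x k.+1).
Proof.
have hX : is_derive x 1 (fun y : R => y ^+ k.+1) (k.+1%:R * x ^+ k).
  apply: DeriveDef; first exact: exprn_derivable.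
  by rewrite exp_derive /GRing.scale /= mulr1.
have h : is_derive x 1
    (k.+1`!%:R^-1 \*: ((fun y : R => y ^+ k.+1) * (fun y => expR (- y))))
    (k.+1`!%:R^-1 *: (x ^+ k.+1 *: - expR (- x) + expR (- x) *: (k.+1%:R * x ^+ k))).
  by apply: is_deriveZ; apply: is_deriveM; exact: is_derive_expRN.
rewrite (_ : poisson_mass ^~ k.+1 =
    k.+1`!%:R^-1 \*: ((fun y : R => y ^+ k.+1) * (fun y => expR (- y)))); last first.
  by apply/funext => y; rewrite /poisson_mass mulrC.
apply: is_derive_eq; rewrite /GRing.scale /= /poisson_mass factS natrM.
have fk (i : nat) : i`!%:R != 0 :> R by rewrite pnatr_eq0 -lt0n fact_gt0.
by field; rewrite fk nat1r pnatr_eq0.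
Qed.

(** The derivatives of the masses telescope, leaving only the last one. *)
Lemma is_derive_poisson_cdf x N :
  is_derive x 1 (poisson_cdf N.+1) (- poisson_mass x N).
Proof.
elim: N => [|N IH].
  rewrite (_ : poisson_cdf 1 = fun x => expR (- x)); last first.
    by apply/funext => y; rewrite /poisson_cdf big_nat1 /poisson_mass expr0 mul1r divr1.
  by rewrite /poisson_mass expr0 mul1r divr1; exact: is_derive_expRN.
rewrite (_ : poisson_cdf N.+2 = poisson_cdf N.+1 + poisson_mass ^~ N.+1); last first.
  by apply/funext => y; rewrite /poisson_cdf big_nat_recr.
have hd := is_derive_poisson_mass x N.
by apply: is_derive_eq; ring.
Qed.

Lemma poisson_cdf_nincr N x y : 0 <= x -> x <= y ->
  poisson_cdf N y <= poisson_cdf N x.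
Proof.
case: N => [|N]; first by rewrite /poisson_cdf !big_geq.
have hd z := is_derive_poisson_cdf z N.
apply: ler0_derive1_nincry => [z _|z|].
- by have [] := hd z.
- rewrite in_itv/= andbT derive1E => /ltW z0; have [_ ->] := hd z.
  by rewrite oppr_le0 poisson_mass_ge0.
- apply: continuous_subspaceT => z; apply: differentiable_continuous.
  by apply/derivable1_diffP; have [] := hd z.
Qed.

End poisson_mass.

(** * Thinning and the branching process *)

Section counting.
Context (R : realType) (d : measure_display) (T : measurableType d)
  (P : probability T R).

Lemma measurable_nat_preimage (f : T -> nat) (B : set nat) :
  (forall k, measurable [set w | f w = k]) -> measurable (f @^-1` B).
Proof.
move=> mf; rewrite (_ : _ @^-1` _ = \bigcup_(k in B) [set w | f w = k]).
  by apply: bigcup_measurable => k _.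
by apply/seteqP; split=> [w Bw|w [k Bk fk]]; [exists (f w)|rewrite /preimage /= fk].
Qed.

Lemma probability_nat_itv (f : T -> nat) (q : nat -> R) (a b : nat) :
  (forall k, measurable [set w | f w = k]) ->
  (forall k, P [set w | f w = k] = (q k)%:E) ->
  P [set w | (a <= f w < b)%N] = (\sum_(a <= k < b) q k)%:E.
Proof.
move=> mf Pf; elim: b => [|b IH].
  rewrite (_ : [set w | _] = set0) ?measure0 ?big_geq//.
  by apply/seteqP; split=> w //=; rewrite ltn0 andbF.
have [ab|ba] := leqP a b; last first.
  rewrite (_ : [set w | _] = set0) ?measure0 ?big_geq//.
  by apply/seteqP; split=> w //=; lia.
rewrite (_ : [set w | _] = [set w | (a <= f w < b)%N] `|` [set w | f w = b]).
  rewrite measureU//.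
  - by rewrite big_nat_recr// EFinD; congr (_ + _)%E; [exact: IH|exact: Pf].
  - exact: (@measurable_nat_preimage f [set k | (a <= k < b)%N]).
  - by apply/seteqP; split=> w //= []; lia.
by apply/seteqP; split=> w /=; [|case]; lia.
Qed.

Definition count_below (e : nat -> T -> bool) (n : nat) (w : T) : nat :=
  count (e ^~ w) (iota 0 n).

Lemma count_belowS e n w : count_below e n.+1 w = (count_below e n w + e n w)%N.
Proof. by rewrite /count_below -addn1 iotaD count_cat /= addn0. Qed.

Lemma count_belowS_eq e n k : [set w | count_below e n.+1 w = k.+1] =
  ([set w | count_below e n w = k] `&` [set w | e n w]) `|`
  ([set w | count_below e n w = k.+1] `&` ~` [set w | e n w]).
Proof.
apply/seteqP; split=> w /=; rewrite count_belowS; case: (e n w) => /=; lia.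
Qed.

Lemma count_belowS_eq0 e n : [set w | count_below e n.+1 w = 0%N] =
  [set w | count_below e n w = 0%N] `&` ~` [set w | e n w].
Proof.
apply/seteqP; split=> w /=; rewrite count_belowS; case: (e n w) => /=; lia.
Qed.

(** Binomial law of successive trials on the event [F]: each trial succeeds with probability a
    independently of [F] joined with the previous count, and Pascal's rule drives the induction. *)
Lemma probability_count_below (F : set T) (e : nat -> T -> bool) (a r : R) :
  (forall n k, measurable (F `&` [set w | count_below e n w = k])) ->
  (forall n, measurable [set w | e n w]) -> P F = r%:E ->
  (forall n k, P (F `&` [set w | count_below e n w = k] `&` [set w | e n w]) =
    (P (F `&` [set w | count_below e n w = k]) * a%:E)%E) ->
  forall n k, P (F `&` [set w | count_below e n w = k]) =
    (r * ('C(n, k)%:R * a ^+ k * (1 - a) ^+ (n - k)))%:E.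
Proof.
move=> mF me PF ind.
have indC n k x : P (F `&` [set w | count_below e n w = k]) = x%:E ->
    P (F `&` ([set w | count_below e n w = k] `&` ~` [set w | e n w])) =
    (x * (1 - a))%:E.
  move=> Px; rewrite setIA -setDE.
  transitivity (x%:E - x%:E * a%:E)%E; last by rewrite -EFinM -EFinB; congr (_%:E); ring.
  have Poo : (P (F `&` [set w | count_below e n w = k]) < +oo)%E by rewrite Px ltry.
  by rewrite -Px -ind; exact: measureD.
elim=> [|n IH] [|k].
- rewrite (_ : _ `&` _ = F) ?PF; last by apply/seteqP; split=> w // [].
  by rewrite !expr0 bin0 !mulr1.
- rewrite (_ : _ `&` _ = set0) ?measure0; last by apply/seteqP; split=> w // [].
  by rewrite bin_small// !mul0r mulr0.
- rewrite count_belowS_eq0 (indC _ _ _ (IH 0%N)) !subn0 !bin0 exprS.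
  by congr (_%:E); ring.
- rewrite count_belowS_eq setIUr.
  transitivity (P (F `&` [set w | count_below e n w = k] `&` [set w | e n w]) +
      P (F `&` ([set w | count_below e n w = k.+1] `&` ~` [set w | e n w])))%E.
    rewrite -setIA; apply: measureU.
    + by rewrite setIA; exact: measurableI.
    + by rewrite setIA -setDE; exact: measurableD.
    + by apply/seteqP; split => w //= [[_ [-> _]] [_ [/n_Sn]]].
  rewrite (indC _ _ _ (IH k.+1)) ind IH -EFinM -EFinD subSS binS natrD.
  (* When n <= k the subtraction [n - k.+1] truncates, but then the binomial coefficient of n over k
     + 1 is zero. *)
  congr (_%:E); have [kn|nk] := ltnP k n.
    by rewrite (_ : (n - k = (n - k.+1).+1)%N) ?exprS; [ring|lia].
  by rewrite (bin_small (m := k.+1))// exprS; ring.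
Qed.

(** Splitting on the value n of [X] gives a binomial law on each piece; the pieces are then
    summed. *)
Lemma poisson_thinning (X : T -> nat) (e : nat -> T -> bool) (m a : R) :
  0 <= m -> 0 <= a <= 1 ->
  (forall n, P [set w | X w = n] = (poisson_mass m n)%:E) ->
  (forall n i k, measurable ([set w | X w = n] `&` [set w | count_below e i w = k])) ->
  (forall i, measurable [set w | e i w]) ->
  (forall n i k,
    P ([set w | X w = n] `&` [set w | count_below e i w = k] `&` [set w | e i w]) =
    (P ([set w | X w = n] `&` [set w | count_below e i w = k]) * a%:E)%E) ->
  forall k, P [set w | count_below e (X w) w = k] = (poisson_mass (m * a) k)%:E.
Proof.
move=> m0 a01 PX mXe me ind k.
rewrite (_ : [set w | _] =
    \bigcup_n ([set w | X w = n] `&` [set w | count_below e n w = k])); last first.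
  by apply/seteqP; split=> [w wk|w [n _ [/= -> ->]]//]; exists (X w).
rewrite measure_semi_bigcup//; last 2 first.
- by move=> n n' _ _ [w /= [[<- _] [<- _]]].
- exact: bigcup_measurable.
rewrite -nneseries_poisson_thinning//.
by apply: eq_eseriesr => n _; apply: probability_count_below.
Qed.

End counting.

(** Division by exp(ms) turns the equation into the fixed-point form s = P(Poisson(ms) >= N). *)
Lemma tau_equationP (R : realType) (m : R) (N : nat) (s : R) :
  tau_equation m N s <-> s = 1 - poisson_cdf N (m * s).
Proof.
have e0 := expR_gt0 (m * s).
rewrite /tau_equation; set S := (X in _ = X).
have -> : poisson_cdf N (m * s) = S / expR (m * s).
  rewrite /poisson_cdf /S mulr_suml; apply: eq_bigr => j _.
  by rewrite /poisson_mass expRN; ring.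
split=> [<-|E]; first by rewrite mulfK ?gt_eqF//; ring.
by rewrite {1}E opprB addrCA subrr addr0 divfK ?gt_eqF.
Qed.

(** * Survival probabilities in the branching process *)

Section branching.
Context (R : realType) (d : measure_display) (T : measurableType d)
  (P : probability T R) (xi : seq nat -> {RV P >-> nat}) (N : nat) (m : R).
Hypothesis xi_ind : mutually_independent xi.
Hypothesis m_ge0 : 0 <= m.
Hypothesis xi_poisson : forall u k,
  P [set w | xi u w = k] = (poisson_mass m k)%:E.

Definition descendants (u : seq nat) : set (seq nat) := [set v | prefix u v].

(* Contains [u] and the descendants of its first [i] children, hence all labels
   on which the fate of these children depends. *)
Definition before_child (u : seq nat) (i : nat) : set (seq nat) :=
  [set v | forall j, (i <= j)%N -> ~~ prefix (rcons u j) v].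

Lemma prefix_rcons_inj (u v : seq nat) i j :
  prefix (rcons u i) v -> prefix (rcons u j) v -> i = j.
Proof.
move=> /prefixP[s ->] /prefixP[t].
by rewrite !cat_rcons => /eqP; rewrite eqseq_cat// => /andP[_ /eqP[]].
Qed.

Lemma generated_count_below (U : set (seq nat)) (e : nat -> T -> bool) n k :
  (forall i, (i < n)%N -> generated xi U [set w | e i w]) ->
  generated xi U [set w | count_below e n w = k].
Proof.
elim: n k => [|n IH] k he.
  have [->|k0] := eqVneq k 0%N.
    rewrite (_ : [set w | _] = setT); last by apply/seteqP; split.
    by apply: sub_sigma_algebra; exact: cylinderT.
  rewrite (_ : [set w | _] = set0); first exact: sigma_algebra0.
  by apply/seteqP; split=> w //= /esym/eqP; rewrite (negPf k0).
have {}IH j : generated xi U [set w | count_below e n w = j].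
  by apply: IH => i ni; apply: he; exact: leqW.
have hn := he n (ltnSn n).
case: k => [|k].
  rewrite count_belowS_eq0; apply: generated_setI; first exact: IH.
  exact: generated_setC.
rewrite count_belowS_eq; apply: generated_setU; apply: generated_setI => //.
exact: generated_setC.
Qed.

(** * Counting children by a property of their own subtree *)

Section children.
Context (u : seq nat) (e : nat -> T -> bool) (a : R).
Hypothesis a01 : 0 <= a <= 1.
Hypothesis e_desc : forall i,
  generated xi (descendants (rcons u i)) [set w | e i w].
Hypothesis e_prob : forall i, P [set w | e i w] = a%:E.

Lemma generated_offspring (U : set (seq nat)) n : U u ->
  generated xi U [set w | xi u w = n].
Proof.
move=> Uu; rewrite -[X in generated xi U X]/(xi u @^-1` [set n]).
exact: generated_preimage.
Qed.

Lemma generated_count_children k :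
  generated xi (descendants u)
    [set w | count_below e (xi u w) w = k].
Proof.
rewrite (_ : [set w | _] =
    \bigcup_n ([set w | xi u w = n] `&` [set w | count_below e n w = k])); last first.
  by apply/seteqP; split=> [w wk|w [n _ [/= -> ->]]//]; exists (xi u w).
apply: generated_bigcup => n; apply: generated_setI.
  by apply: generated_offspring; exact: prefix_refl.
apply: generated_count_below => i _.
apply: (generated_sub _ (@e_desc i)) => v /=.
by apply: prefix_trans; exact: prefix_rcons.
Qed.

Lemma count_children_poisson k :
  P [set w | count_below e (xi u w) w = k] = (poisson_mass (m * a) k)%:E.
Proof.
(* The offspring number of [u] and the fate of its first [i] children depend only on labels in
   [before_child u i], which is disjoint from the descendants of child [i]. This yields the
   independence needed for thinning. *)
have hn n i j : generated xi (before_child u i)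
    ([set w | xi u w = n] `&` [set w | count_below e i w = j]).
  apply: generated_setI.
    apply: generated_offspring => l _; apply/negP => /size_prefix.
    by rewrite size_rcons ltnn.
  apply: generated_count_below => l li.
  apply: (generated_sub _ (@e_desc l)) => v /= lv l' il'; apply/negP => l'v.
  by have := prefix_rcons_inj lv l'v; lia.
apply: poisson_thinning => //.
- by move=> n i j; exact: generated_measurable (hn n i j).
- by move=> i; exact: generated_measurable (@e_desc i).
- move=> n i j; rewrite -(e_prob i).
  apply: (generated_independent xi_ind _ (hn n i j) (@e_desc i)) => //.
  by move=> v [/(_ i (leqnn i))/negP].
Qed.

Lemma generated_count_children_ge :
  generated xi (descendants u)
    [set w | (N <= count_below e (xi u w) w)%N].
Proof.
rewrite (_ : [set w | _] =
    \bigcup_k [set w | count_below e (xi u w) w = N + k]%N); last first.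
  apply/seteqP; split=> [w wk|w [n _ /= ->]]; last exact: leq_addr.
  by exists (count_below e (xi u w) w - N)%N => //=; rewrite subnKC.
by apply: generated_bigcup => k; exact: generated_count_children.
Qed.

Lemma probability_count_children_ge :
  P [set w | (N <= count_below e (xi u w) w)%N] =
  (1 - poisson_cdf N (m * a))%:E.
Proof.
have mk k : measurable [set w | count_below e (xi u w) w = k].
  exact: generated_measurable (generated_count_children k).
rewrite (_ : [set w | _] =
    ~` [set w | (0 <= count_below e (xi u w) w < N)%N]); last first.
  by apply/seteqP; split=> w /= h;
    [apply/negP; rewrite -leqNgt|rewrite leqNgt; apply/negP].
rewrite probability_setC; last first.
  exact: (@measurable_nat_preimage _ _ _ [set k | (0 <= k < N)%N]).
by rewrite (probability_nat_itv _ _ mk count_children_poisson) -EFinB.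
Qed.

End children.

(** The iterates a_n, started at 1, of the map taking s to P(Poisson(ms) >= N). *)
Definition Nary_prob (n : nat) : R :=
  iter n (fun s => 1 - poisson_cdf N (m * s)) 1.

(** Both claims go through one induction: thinning at [u] needs the children's events to live on
    their own subtrees and to have a common probability. *)
Lemma has_Nary_generated_prob n u :
  generated xi (descendants u)
    [set w | has_Nary N (xi ^~ w) n u] /\
  P [set w | has_Nary N (xi ^~ w) n u] = (Nary_prob n)%:E.
Proof.
elim: n u => [|n IH] u.
  rewrite (_ : [set w | _] = setT); last by apply/seteqP; split.
  split; last exact: probability_setT.
  by apply: sub_sigma_algebra; exact: cylinderT.
pose e i w := has_Nary N (xi ^~ w) n (rcons u i).
have a01 : 0 <= Nary_prob n <= 1.
  have [hg hp] := IH u; rewrite -!lee_fin -hp measure_ge0 probability_le1//.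
  exact: generated_measurable hg.
split.
  by apply: (@generated_count_children_ge u e) => i; have [] := IH (rcons u i).
apply: (@probability_count_children_ge u e _ a01) => i; by have [] := IH (rcons u i).
Qed.

Lemma survives_bigcap u : [set w | survives N (xi ^~ w) u] =
  \bigcap_n [set w | has_Nary N (xi ^~ w) n u].
Proof.
apply/seteqP; split=> w /= => [/asboolP h n _|h]; first exact: h.
by apply/asboolP => n; exact: h.
Qed.

Lemma generated_survives u : generated xi (descendants u)
  [set w | survives N (xi ^~ w) u].
Proof.
rewrite survives_bigcap; apply: generated_bigcap => n.
by have [] := has_Nary_generated_prob n u.
Qed.

(** Continuity from above: the events of having an N-ary tree of height n decrease to survival. *)
Lemma Nary_prob_cvg u :
  (EFin \o Nary_prob) @ \oo --> P [set w | survives N (xi ^~ w) u].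
Proof.
have mA n : measurable [set w | has_Nary N (xi ^~ w) n u].
  by have [h _] := has_Nary_generated_prob n u; exact: generated_measurable h.
have -> : EFin \o Nary_prob = P \o (fun n => [set w | has_Nary N (xi ^~ w) n u]).
  by apply/funext => n /=; have [_ ->] := has_Nary_generated_prob n u.
rewrite survives_bigcap; apply: nonincreasing_cvg_mu => //.
- exact: le_lt_trans (probability_le1 P (mA 0%N)) (ltry _).
- exact: bigcapT_measurable.
- by move=> n n' nn'; apply/subsetPset => w /=; exact: has_Nary_leq.
Qed.

Lemma probability_survives (tau : R) (u : seq nat) : largest_solution m N tau ->
  P [set w | survives N (xi ^~ w) u] = tau%:E.
Proof.
move=> [/andP[tau0 tau1] /tau_equationP tauE tau_max].
have mS v : measurable [set w | survives N (xi ^~ w) v].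
  exact: generated_measurable (@generated_survives v).
set a := fine (P [set w | survives N (xi ^~ w) u]).
(* All labels share the same survival probability, since each is the limit of the same sequence
   a_n. *)
have PE v : P [set w | survives N (xi ^~ w) v] = a%:E.
  rewrite fineK ?fin_num_measure//.
  have hv := @Nary_prob_cvg v; have hu := @Nary_prob_cvg u.
  by rewrite -(cvg_lim _ hv)// -(cvg_lim _ hu).
have a01 : 0 <= a <= 1 by rewrite -!lee_fin -(PE u) measure_ge0 probability_le1.
rewrite PE; congr (_%:E); apply/eqP; rewrite eq_le; apply/andP; split.
  (* Survival of [u] means at least N surviving children, so [a] solves the equation and is at most
     its largest solution. *)
  apply: tau_max => //; apply/tau_equationP/EFin_inj; rewrite -(PE u).
  rewrite -(@probability_count_children_ge u
    (fun i w => survives N (xi ^~ w) (rcons u i)))//.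
  - by congr (P _); apply/seteqP; split=> w /=; rewrite survivesE size_filter.
  - by move=> i; exact: generated_survives.
(* The map is monotone and fixes [tau], so starting from 1 >= [tau] every iterate stays above
   [tau]. *)
have tau_le n : tau <= Nary_prob n.
  elim: n => [//|n IH]; rewrite /= {1}tauE lerD2l lerN2.
  by apply: poisson_cdf_nincr; rewrite ?mulr_ge0// ler_wpM2l.
rewrite -lee_fin -(PE u); have h := @Nary_prob_cvg u.
rewrite -(cvg_lim _ h)//; apply: lime_ge; first by apply/cvg_ex; eexists; exact: h.
by apply: nearW => n /=; rewrite lee_fin.
Qed.

End branching.

(** * The law of V_N *)

Unset Implicit Arguments.

Theorem proposition2 (R : realType)
    (N : nat) (hN : (1 <= N)%N) (m : R) (hm : 0 < m)
    (d : measure_display) (T : measurableType d) (P : probability T R)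
    (p : nat -> R) (xi : seq nat -> {RV P >-> nat})
    (hxi : BGW_process p xi)
    (hp : forall s : R, 0 <= s <= 1 -> pgf p s = (expR (m * (s - 1)))%:E)
    (tau : R) (htau : largest_solution m N tau)
    (d' : measure_display) (T' : measurableType d') (P' : probability T' R)
    (Y : {RV P' >-> nat})
    (hY : forall k : nat, P' [set w | Y w = k] =
       ((m * tau) ^+ k * expR (- (m * tau)) / k`!%:R)%:E) :
  forall j : nat,
    measurable [set w | V xi N w = j] /\
    P [set w | V xi N w = j] =
      P' [set w | (j * N <= Y w <= j * N + N - 1)%N].
Proof.
have [xi_ind xi_p] := hxi.
have m0 := ltW hm.
(* The offspring law is given only through its generating function on [0,1], which determines the
   coefficients. *)
have pE : p = poisson_mass m.
  apply: (@pgf_inj _ _ _ (fun s => expR (m * (s - 1)))) => //.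
  - by move=> k; rewrite -lee_fin -(xi_p [::]) measure_ge0.
  - by move=> k; exact: poisson_mass_ge0.
  - by move=> s /andP[s0 _]; exact: pgf_poisson.
have xi_poisson u k : P [set w | xi u w = k] = (poisson_mass m k)%:E.
  by rewrite -pE -(xi_p u).
pose e i w := survives N (xi ^~ w) (rcons [::] i).
have e_desc i := @generated_survives _ _ _ _ xi N m xi_ind m0 xi_poisson (rcons [::] i).
have e_prob i := probability_survives xi_ind m0 xi_poisson (rcons [::] i) htau.
have tau01 : 0 <= tau <= 1 by case: htau.
pose Z w := count_below e (xi [::] w) w.
have Z_prob k : P [set w | Z w = k] = (poisson_mass (m * tau) k)%:E.
  exact: (@count_children_poisson _ _ _ _ xi m xi_ind m0 xi_poisson [::] e tau).
have mZ k : measurable [set w | Z w = k].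
  have h := @generated_count_children _ _ _ _ xi [::] e e_desc k.
  exact: generated_measurable h.
have mY k : measurable [set w | Y w = k].
  rewrite -[X in measurable X]/(Y @^-1` [set k]) -[X in measurable X]setTI.
  exact: measurable_funPT.
have Y_prob k : P' [set w | Y w = k] = (poisson_mass (m * tau) k)%:E := hY k.
move=> j.
(* V_N is the quotient of [Z] by N, so the value j corresponds to a block of N consecutive values of
   [Z]. *)
have -> : [set w | V xi N w = j] = [set w | (j * N <= Z w < j * N + N)%N].
  apply/seteqP; split=> w /=; rewrite /V max_disjoint_NaryE// size_filter -/(Z w).
    by move=> <-; rewrite leq_divM -mulSnr ltn_ceil.
  move=> /andP[h1 h2]; apply/eqP; rewrite eqn_leq leq_divRL// h1 andbT.
  by rewrite -ltnS ltn_divLR// mulSnr.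
split; first exact: (@measurable_nat_preimage _ _ _ [set k | (j * N <= k < j * N + N)%N]).
rewrite (probability_nat_itv _ _ mZ Z_prob).
rewrite -(probability_nat_itv _ _ mY Y_prob); congr (P' _).
(* Since N >= 1, the bound [j * N + N - 1] does not truncate and is equivalent to the strict bound
   [j * N + N]. *)
by apply/seteqP; split=> w /=; lia.
Qed.
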